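(* Let $n\ge 3$ and let $G$ and $H$ be graphs on $n$ vertices that have at least $\frac{2n}{3}+1$ common cards. Then $G$ and $H$ have the same girth. (Equivalently: the girth of a graph on $n$ vertices can be determined from any $\frac{2n}{3}+1$ of its cards.)
   Context: All graphs are finite and simple. The girth of a graph is the length of its shortest cycle, and is $\infty$ if the graph has no cycle. For a graph $X$ and a vertex $v$, the card $X-v$ is the unlabeled graph obtained by deleting $v$ and its incident edges; the deck of $X$ is the multiset $\{X-v : v\in V(X)\}$. The number of common cards of two graphs $X,Y$ on the same number of vertices is the size of the multiset intersection of their decks, i.e. the largest $m$ such that there are distinct vertices $x_1,\dots,x_m$ of $X$ and distinct vertices $y_1,\dots,y_m$ of $Y$ with $X-x_i\cong Y-y_i$ for all $i$. *)

(* Defs.v *)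
From mathcomp Require Import all_boot.

Set Implicit Arguments.
Unset Strict Implicit.
Unset Printing Implicit Defensive.

Record sgraph := SGraph {
  vertex :> finType;
  adj : rel vertex;
  adj_sym : symmetric adj;
  adj_irrefl : irreflexive adj }.

Section Delete.
Variables (G : sgraph) (v : G).

Definition del_adj : rel {x : G | x != v} := fun x y => adj (val x) (val y).

Lemma del_adj_sym : symmetric del_adj.
Proof. by move=> x y; apply: adj_sym. Qed.

Lemma del_adj_irrefl : irreflexive del_adj.
Proof. by move=> x; apply: adj_irrefl. Qed.

(* A labelled representative of the card G - v; cards are only ever compared
   up to isomorphism. *)
Definition delete : sgraph := SGraph del_adj_sym del_adj_irrefl.
End Delete.

Definition isomorphic (G H : sgraph) : bool :=
  [exists f : {ffun G -> H}, exists g : {ffun H -> G},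
    [&& [forall x, g (f x) == x], [forall y, f (g y) == y]
      & [forall x, forall y, adj (f x) (f y) == adj x y]]].

Lemma isomorphicP (G H : sgraph) :
  reflect (exists2 f : G -> H, bijective f & forall x y, adj (f x) (f y) = adj x y)
          (isomorphic G H).
Proof.
apply: (iffP existsP) => [[f /existsP[g /and3P[/forallP fK /forallP gK fE]]]|].
  exists f; last by move=> x y; exact: (eqP (forallP (forallP fE x) y)).
  by exists g => x; [apply/eqP/fK | apply/eqP/gK].
move=> [f [g fK gK] fE]; exists [ffun x => f x]; apply/existsP.
exists [ffun y => g y]; apply/and3P; split; apply/forallP => x.
- by rewrite !ffunE fK.
- by rewrite !ffunE gK.
- by apply/forallP => y; rewrite !ffunE fE.
Qed.

Definition share_cards (G H : sgraph) (m : nat) : bool :=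
  [exists x : {ffun 'I_m -> G}, exists y : {ffun 'I_m -> H},
    [&& injectiveb x, injectiveb y
      & [forall i, isomorphic (delete (x i)) (delete (y i))]]].

Lemma share_cardsP (G H : sgraph) (m : nat) :
  reflect (exists x : 'I_m -> G, exists y : 'I_m -> H,
             [/\ injective x, injective y
               & forall i, isomorphic (delete (x i)) (delete (y i))])
          (share_cards G H m).
Proof.
apply: (iffP existsP) => [[x /existsP[y /and3P[xI yI xy]]]|[x [y [xI yI xy]]]].
  by exists x, y; split; [apply/injectiveP | apply/injectiveP | apply/forallP].
exists (finfun x); apply/existsP; exists (finfun y).
apply/and3P; split; last by apply/forallP => i; rewrite !ffunE.
- by apply/injectiveP => i j; rewrite !ffunE => /xI.
- by apply/injectiveP => i j; rewrite !ffunE => /yI.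
Qed.

Definition common_cards (G H : sgraph) : nat :=
  \max_(m < #|G|.+1 | share_cards G H m) m.

(* The bound on m in common_cards excludes nothing, and the maximum is attained. *)
Lemma common_cards_max (G H : sgraph) :
  share_cards G H (common_cards G H) /\
  forall m, share_cards G H m -> m <= common_cards G H.
Proof.
have s0 : share_cards G H (ord0 : 'I_#|G|.+1).
  by apply/share_cardsP; do 2![exists (fun i : 'I_0 => match i with Ordinal _ h =>
    False_rect _ (notF h) end)]; split=> -[].
split=> [|m sm].
  rewrite /common_cards.
  rewrite (@bigmax_eq_arg _ ord0 (fun m : 'I_#|G|.+1 => share_cards G H m)) //.
  by case: arg_maxnP.
have lem : m < #|G|.+1.
  have /share_cardsP[x [_ [xI _ _]]] := sm.
  by have := leq_card x xI; rewrite card_ord ltnS.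
exact: (@leq_bigmax_cond _ (fun i : 'I_#|G|.+1 => share_cards G H i)
          val (Ordinal lem) sm).
Qed.

Definition is_cycle (G : sgraph) (c : seq G) : bool :=
  (2 < size c) && ucycleb (@adj G) c.

Definition has_cycle (G : sgraph) (k : nat) : bool :=
  [exists c : k.-tuple G, is_cycle c].

(* None stands for infinity. *)
Definition girth (G : sgraph) : option nat :=
  if [pick k : 'I_#|G|.+1 | has_cycle G k] is Some k0
  then Some (val [arg min_(k < k0 | has_cycle G k) val k]) else None.

Lemma has_cycleP (G : sgraph) (k : nat) :
  reflect (exists2 c : seq G, is_cycle c & size c = k) (has_cycle G k).
Proof.
apply: (iffP existsP) => [[c cc]|[c cc <-]]; first by exists c; rewrite ?size_tuple.
by exists (in_tuple c).
Qed.

Lemma has_cycle_bound (G : sgraph) (k : nat) : has_cycle G k -> k < #|G|.+1.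
Proof.
by move=> /has_cycleP[c /andP[_ /andP[_ /card_uniqP <-]] <-]; apply: max_card.
Qed.

Lemma girth_SomeP (G : sgraph) (k : nat) :
  girth G = Some k <->
  (exists2 c : seq G, is_cycle c & size c = k) /\
  (forall c : seq G, is_cycle c -> k <= size c).
Proof.
rewrite /girth; case: pickP => [k0 k0P|none]; last first.
  split=> [//|[/has_cycleP kP _]].
  by have := none (Ordinal (has_cycle_bound kP)); rewrite /= kP.
case: arg_minnP => // j jP jmin.
have jle (c : seq G) : is_cycle c -> j <= size c.
  move=> cc; have cP : has_cycle G (size c) by apply/has_cycleP; exists c.
  exact: (jmin (Ordinal (has_cycle_bound cP)) cP).
split=> [[<-]|[[c cc <-] cmin]]; first by split=> //; apply/has_cycleP.
have /has_cycleP[d dc dj] := jP.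
by congr Some; apply/eqP; rewrite eqn_leq jle //= -dj cmin.
Qed.

Lemma girth_NoneP (G : sgraph) :
  girth G = None <-> forall c : seq G, ~~ is_cycle c.
Proof.
rewrite /girth; case: pickP => [k0 /has_cycleP[c cc _]|none].
  by split=> // /(_ c); rewrite cc.
split=> // _ c; apply/negP => cc.
have cP : has_cycle G (size c) by apply/has_cycleP; exists c.
by have := none (Ordinal (has_cycle_bound cP)); rewrite /= cP.
Qed.

(* Main.v *)
Require Import Defs.
From mathcomp Require Import all_boot all_order all_algebra.
From mathcomp Require Import zify lra.

Set Implicit Arguments.
Unset Strict Implicit.
Unset Printing Implicit Defensive.

(* Let c be a shortest cycle of G, of length g, and suppose that every cycle of
   H is longer.  A card G - v with v off c still contains c, so the m common
   cards all delete vertices x_i of c; hence g >= m >= 2n/3 + 1, and a theta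
   graph does not fit into n vertices without a cycle shorter than g: the parts
   of G hanging at the different vertices of c are disjoint.

   If H has a cycle, it is longer than g, so each G - x_i has a path on at least
   g vertices.  Such a path makes up for the vertices of c around x_i that it
   misses inside the parts hanging at its two ends, so x_i is within distance k
   on c of a vertex carrying k hanging vertices.  Thus m <= 2(n - g), which is
   impossible.

   If H is acyclic, let I be the set of i with deg x_i = 2; then |I| >= m + g - n.
   By edge counting deg x_i - deg y_i does not depend on i.
   - If y_i has degree at most 1 for i in I, these y_i avoid the interior of any
     path of H, and H has a path on g - 1 vertices, and on g vertices if some x_i
     has degree at least 3 and m = g.
   - Otherwise all y_i have degree at least 2.  Let B_i be the component of
     H - y_i matching that of c - x_i in G - x_i; its size is maximal for i in I.
     Maximality puts y_j into B_i for all j <> i, and since H is acyclic y_i has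
     a neighbour z_i outside B_i.  The z_i are distinct and differ from every
     y_j, so m + |I| <= n, which is impossible. *)

(** * Joining, reversing and splitting paths *)

Lemma is_cycle_join (G : sgraph) (u v : G) (p q : seq G) :
  path (@adj G) u (rcons p v) -> path (@adj G) v (rcons q u) ->
  uniq (u :: p ++ v :: q) -> 0 < size p + size q ->
  is_cycle (u :: p ++ v :: q).
Proof.
move=> up vq uq pq; apply/and3P; split=> //; first by rewrite /= size_cat /=; lia.
by rewrite /= rcons_cat rcons_cons -cat_rcons cat_path up last_rcons.
Qed.

Lemma rev_path_adj (G : sgraph) (u v : G) (p : seq G) :
  path (@adj G) u (rcons p v) -> path (@adj G) v (rcons (rev p) u).
Proof.
move=> up; have := rev_path (@adj G) u (rcons p v).
rewrite last_rcons belast_rcons rev_cons => ->.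
by rewrite (eq_path (e' := @adj G)) // => a b; rewrite adj_sym.
Qed.

Lemma rev_sorted_adj (G : sgraph) (p : seq G) :
  sorted (@adj G) p -> sorted (@adj G) (rev p).
Proof.
by rewrite rev_sorted (eq_sorted (e' := @adj G)) // => a b; rewrite adj_sym.
Qed.

(** Closure is asked only at vertices of the walk, so [S] may have edges leaving it elsewhere. *)
Lemma path_stay (G : sgraph) (S : {set G}) (w : G) (s : seq G) :
  path (@adj G) w s -> w \in S ->
  (forall a b, a \in S -> adj a b -> b \in s -> b \in S) ->
  {subset s <= S}.
Proof.
elim: s w => [|b s IHs] w //= /andP[wb bs] wS stay.
have bS : b \in S by apply: (stay w) => //; rewrite inE eqxx.
move=> a; rewrite inE => /predU1P[->//|]; apply: (IHs b) => // a' b' a'S ab bs'.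
by apply: (stay a') => //; rewrite inE bs' orbT.
Qed.

(** Both halves are read outwards from [w], whence the [rev]. *)
Lemma sorted_split (G : sgraph) (w : G) (p : seq G) :
  sorted (@adj G) p -> w \in p ->
  exists p1 p2, [/\ p = rev p1 ++ w :: p2, path (@adj G) w p1
                  & path (@adj G) w p2].
Proof.
move=> sp wp; case: (splitPr wp) => p1 p2 in sp *.
exists (rev p1), p2; rewrite revK; split=> //.
  have := rev_sorted_adj sp; rewrite rev_cat rev_cons cat_rcons.
  by move/cat_sorted2 => [_].
by have [_] := cat_sorted2 sp.
Qed.

Lemma sorted_stay (G : sgraph) (S : {set G}) (w : G) (p : seq G) :
  sorted (@adj G) p -> w \in p -> w \in S ->
  (forall a b, a \in S -> adj a b -> b \in p -> b \in S) ->
  {subset p <= S}.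
Proof.
move=> sp /(sorted_split sp)[p1 [p2 [-> wp1 wp2]]] wS stay a.
rewrite mem_cat inE mem_rev => /or3P[ap1|/eqP->//|ap2].
- apply: (path_stay wp1) => // u v uS uv vp1; apply: stay uv _ => //.
  by rewrite mem_cat mem_rev vp1.
- apply: (path_stay wp2) => // u v uS uv vp2; apply: stay uv _ => //.
  by rewrite mem_cat inE vp2 !orbT.
Qed.

(* A path that enters [S] and leaves it on both sides would use the only
   gate [z] twice. *)
Lemma sorted_exit (G : sgraph) (S : {set G}) (z w x0 : G) (p : seq G) :
  sorted (@adj G) p -> uniq p -> w \in p -> w \in S -> z \notin S ->
  (forall a b, a \in S -> adj a b -> b \in p -> b \notin S -> b = z) ->
  (head x0 p \in S) || (last x0 p \in S).
Proof.
move=> sp up wp wS zS gate.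
have [p1 [p2 [def_p wp1 wp2]]] := sorted_split sp wp.
have stay s : {subset s <= p} -> z \notin s -> path (@adj G) w s ->
    last w s \in S.
  move=> sub zs ws; have /allP/(_ (last w s)) : all [in S] (w :: s).
    apply/allP=> a; rewrite inE => /predU1P[->//|].
    apply: (path_stay ws) => // a' b' a'S ab bs; apply: contraNT zs => bS.
    by rewrite -(gate _ _ a'S ab (sub _ bs) bS).
  by apply; apply: mem_last.
have [zp2|zp2] := boolP (z \in p2); last first.
  rewrite {2}def_p last_cat /= (stay p2) ?orbT // => a ap2.
  by rewrite def_p mem_cat inE ap2 !orbT.
have zp1 : z \notin p1.
  move: up; rewrite def_p cat_uniq => /and3P[_ + _]; apply: contra => zp1.
  by apply/hasP; exists z; rewrite ?inE ?zp2 ?orbT //= mem_rev.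
suff -> : head x0 p = last w p1.
  by rewrite stay // => a ap1; rewrite def_p mem_cat mem_rev ap1.
rewrite def_p; case/lastP: (p1) => //= q a.
by rewrite rev_rcons last_rcons.
Qed.

(** * The parts hanging at a shortest cycle *)

Definition degree (G : sgraph) (v : G) : nat := #|[set u | adj v u]|.

Definition off_adj (G : sgraph) (c : seq G) : rel G :=
  fun u w => [&& adj u w, u \notin c & w \notin c].

(** The part of the graph hanging at [v]. It is empty for [v] off [c], so that sums may run over all
    vertices. *)
Definition branch (G : sgraph) (c : seq G) (v : G) : {set G} :=
  [set w | (v \in c) &&
    [exists u, [&& u \notin c, adj v u & connect (off_adj c) u w]]].

Section ShortestCycle.
Variables (G : sgraph) (n : nat) (c : seq G).
Hypothesis card_G : #|G| = n.
Hypothesis c_cycle : is_cycle c.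
Hypothesis c_min : forall d : seq G, is_cycle d -> size c <= size d.
Hypothesis c_long : 2 * n + 3 <= 3 * size c.

Let c_gt2 : 2 < size c. Proof. by case/andP: c_cycle. Qed.
Let c_uniq : uniq c. Proof. by case/and3P: c_cycle. Qed.
Let c_adj : cycle (@adj G) c. Proof. by case/and3P: c_cycle. Qed.

Lemma size_off_cycle (s : seq G) :
  uniq s -> all [predC c] s -> size s + size c <= n.
Proof.
move=> us sc; rewrite -size_cat; have /card_uniqP <- : uniq (s ++ c).
  rewrite cat_uniq us c_uniq andbT; apply/hasPn => a ac.
  by apply/negP => /(allP sc); rewrite inE ac.
by rewrite -card_G; exact: max_card.
Qed.

(* An ear on the cycle makes a theta graph, one of whose cycles has length at
   most half of [size c] plus the length of the ear. *)
Lemma no_ear (u v : G) (s : seq G) :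
  u \in c -> v \in c -> u != v -> path (@adj G) u (rcons s v) -> uniq s ->
  all [predC c] s -> s = [::] /\ (v = next c u \/ u = next c v).
Proof.
move=> uc vc uv us uniq_s sc.
have [i [p1 [p2 def_c]]] :
    exists i, exists p1 p2 : seq G, rot i c = u :: p1 ++ v :: p2.
  by have [i p1 p2 _ _ def_c] := rot_to_arc c_uniq uc vc uv; exists i, p1, p2.
have size_c : size p1 + size p2 + 2 = size c.
  by rewrite -(size_rot i c) def_c /= size_cat /=; lia.
have up : uniq (u :: p1 ++ v :: p2) by rewrite -def_c rot_uniq.
have /andP[path1 path2] : path (@adj G) u (rcons p1 v) && path (@adj G) v (rcons p2 u).
  have : cycle (@adj G) (rot i c) by rewrite rot_cycle.
  by rewrite def_c /= rcons_cat rcons_cons -cat_rcons cat_path last_rcons.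
have in_c a : (a \in c) = (a \in u :: p1 ++ v :: p2) by rewrite -def_c mem_rot.
have s_p1 : ~~ has [in s] p1.
  apply/hasPn => a ap1; apply/negP => /(allP sc).
  by rewrite inE in_c inE mem_cat ap1 orbT.
have s_p2 : ~~ has [in s] p2.
  apply/hasPn => a ap2; apply/negP => /(allP sc).
  by rewrite inE in_c inE mem_cat inE ap2 !orbT.
have us' : u \notin s by apply/negP => /(allP sc); rewrite inE uc.
have vs' : v \notin s by apply/negP => /(allP sc); rewrite inE vc.
move: (up); rewrite /= mem_cat inE !negb_or cat_uniq /= negb_or.
case/and5P=> /and3P[up1 _ up2] uniq1 /andP[vp1 _] vp2 uniq2.
have cyc1 : 0 < size p1 + size s -> size c <= size p1 + size s + 2.
  move=> pos; rewrite (_ : _ + 2 = size (u :: p1 ++ v :: rev s)); last first.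
    by rewrite addn2 /= size_cat /= size_rev addnS.
  apply/c_min/is_cycle_join; rewrite ?size_rev //; first exact: rev_path_adj.
  rewrite /= mem_cat inE !negb_or up1 uv mem_rev us' cat_uniq /= rev_uniq.
  rewrite negb_or vp1 mem_rev vs' uniq_s uniq1 !andbT /=.
  by apply: contra s_p1 => /hasP[a ap1 sa]; apply/hasP; exists a; rewrite // -mem_rev.
have cyc2 : 0 < size s + size p2 -> size c <= size s + size p2 + 2.
  move=> pos; rewrite (_ : _ + 2 = size (u :: s ++ v :: p2)); last first.
    by rewrite addn2 /= size_cat /= addnS.
  apply/c_min/is_cycle_join => //.
  rewrite /= mem_cat inE !negb_or us' uv up2 cat_uniq /= negb_or.
  by rewrite vs' uniq_s vp2 uniq2 s_p2.
have := size_off_cycle uniq_s sc; case: s => [|a s] in us uniq_s sc s_p1 s_p2 us' vs' cyc1 cyc2 *.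
  move=> _; split=> //.
  have nextE a : next c a = next (rot i c) a by rewrite next_rot.
  move: (posnP (size p1)) (posnP (size p2)); rewrite /= !addn0 add0n in cyc1 cyc2 *.
  case=> [/size0nil p10|p10]; first by left; rewrite nextE def_c p10 /= eqxx.
  case=> [/size0nil p20|p20]; last first.
    by exfalso; move: (cyc1 p10) p20; clear -size_c; lia.
  (* Here [v] comes last in [rot i c], and the default value of [nth] in [next_nth] is the head
     [u]. *)
  right; rewrite nextE def_c p20 cats1 next_nth inE mem_rcons inE eqxx orbT.
  have -> : index v (u :: rcons p1 v) = (size p1).+1.
    by rewrite /= (negPf uv) -cats1 index_cat (negPf vp1) /= eqxx addn0.
  by rewrite nth_default // size_rcons.
(* The two bounds add up to [size c <= 2 * size s + 2] for the whole ear [s]; with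
   [size s + size c <= n] this contradicts [c_long]. *)
have /= := cyc2 isT; have /= := cyc1 (ltn_addl _ (ltn0Sn _)).
clear -size_c c_long; move=> *; exfalso; lia.
Qed.

Lemma off_connect_sym : connect_sym (off_adj c).
Proof.
by apply: sym_connect_sym => u w; rewrite /off_adj adj_sym [RHS]andbCA andbA andbC andbA.
Qed.

Lemma branchP (v w : G) :
  reflect [/\ v \in c, w \notin c & exists2 u, adj v u &
             exists2 s, path (off_adj c) u s & w = last u s /\ all [predC c] (u :: s)]
          (w \in branch c v).
Proof.
have all_off u s : u \notin c -> path (off_adj c) u s -> all [predC c] (u :: s).
  move=> uc us; rewrite /= uc /=; elim: s u us {uc} => //= a s IHs u.
  by case/andP=> /and3P[_ _ ac] /IHs ->; rewrite andbT.
rewrite inE; apply: (iffP andP) => [[vc /existsP[u /and3P[uc vu /connectP[s us ->]]]]|].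
  have us_off := all_off u s uc us; split=> //; last by exists u => //; exists s.
  by move/allP: us_off => /(_ _ (mem_last u s)).
case=> vc wc [u vu [s us [-> /= /andP[uc _]]]]; split=> //.
by apply/existsP; exists u; rewrite uc vu; apply/connectP; exists s.
Qed.

Lemma branch_mem (v w : G) : w \in branch c v -> v \in c.
Proof. by case/branchP. Qed.

Lemma branch_off (v w : G) : w \in branch c v -> w \notin c.
Proof. by case/branchP. Qed.

Lemma branch_nbr (v w : G) :
  v \in c -> w \notin c -> adj v w -> w \in branch c v.
Proof.
move=> vc wc vw; apply/branchP; split=> //; exists w => //.
by exists [::]; rewrite //= wc.
Qed.

(** A vertex hanging at two places would yield an ear with nonempty interior, which [no_ear]
    excludes. *)
Lemma branch_inj (v v' w : G) :
  w \in branch c v -> w \in branch c v' -> v = v'.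
Proof.
rewrite !inE => /andP[vc /existsP[u /and3P[uc vu uw]]].
case/andP=> v'c /existsP[u' /and3P[u'c v'u' u'w]].
have /connectP[s us def_u'] : connect (off_adj c) u u'.
  by apply: connect_trans uw _; rewrite off_connect_sym.
apply/eqP; apply/negPn/negP => vv'.
case: (shortenP us) => s' us' uniq_s' _ in def_u' *.
have [] // := no_ear vc v'c vv' _ uniq_s'.
  rewrite rcons_path /= -def_u' (adj_sym u') v'u' andbT vu /=.
  by apply: sub_path us' => a b /and3P[].
rewrite /= uc /=; elim: s' u us' {us uw uc vu def_u' uniq_s'} => //= a s' IHs u.
by case/andP=> /and3P[_ _ ac] /IHs ->; rewrite andbT.
Qed.

(** A neighbour on [c] would carry [w] in its own branch, so by [branch_inj] it is the root: a
    branch has no other gate. *)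
Lemma branch_step (v w u : G) :
  w \in branch c v -> adj w u -> u \in branch c v \/ u = v.
Proof.
move=> wv wu; have wc := branch_off wv; have [uc|uc] := boolP (u \in c).
  by right; apply: branch_inj wv; apply: branch_nbr; rewrite // adj_sym.
left; move: wv; rewrite !inE => /andP[-> /existsP[a /and3P[ac va aw]]] /=.
apply/existsP; exists a; rewrite ac va; apply: connect_trans aw (connect1 _).
by rewrite /off_adj wu wc.
Qed.

Lemma sum_branch : \sum_v #|branch c v| + size c <= n.
Proof.
have dis u v : u != v -> [disjoint branch c u & branch c v].
  move=> uv; apply/pred0P=> w /=; apply: contraNF uv => /andP[wu wv].
  exact/eqP/(branch_inj wu wv).
have -> : \sum_v #|branch c v| = #|\bigcup_v branch c v|.
  rewrite -sum1_card partition_disjoint_bigcup //=.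
  by apply: eq_bigr => v _; rewrite sum1_card.
have := @size_off_cycle (enum (\bigcup_v branch c v)); rewrite -cardE; apply.
  exact: enum_uniq.
by apply/allP=> w; rewrite mem_enum => /bigcupP[v _ /branch_off].
Qed.

(** A third neighbour on [c] would be the end of a chord. *)
Lemma off_nbr (v : G) :
  v \in c -> 2 < degree v -> exists2 w, w \notin c & adj v w.
Proof.
move=> vc deg_v; suff /subsetPn[w] : ~~ ([set u | adj v u] \subset [set next c v; prev c v]).
  rewrite !inE negb_or => vw /andP[w_next w_prev]; exists w => //.
  apply/negP => wc; have vw' : v != w by apply: contraTneq vw => ->; rewrite adj_irrefl.
  have [] := @no_ear v w [::] vc wc vw'; rewrite //= ?vw // => _ [def_w|def_v].
    by rewrite def_w eqxx in w_next.
  by rewrite def_v prev_next ?eqxx in w_prev.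
apply: contraL deg_v => /subset_leq_card; rewrite cards2 -leqNgt.
by move/leq_trans; apply; case: (_ != _).
Qed.

(** Each of these vertices has a nonempty branch, and the branches are disjoint and off [c]. *)
Lemma card_degree_gt2 : #|[set v in c | 2 < degree v]| + size c <= n.
Proof.
apply: leq_trans sum_branch; rewrite leq_add2r -sum1_card big_mkcond.
apply: leq_sum => v _; case: ifP => // /[!inE] /andP[vc /(off_nbr vc)[w wc vw]].
by rewrite card_gt0; apply/set0Pn; exists w; apply: branch_nbr.
Qed.

(* The number of vertices hanging at [v] bounds how far along the cycle, in
   either direction, [v] marks. *)
Definition marked (x : G) : Prop :=
  exists v d, d < #|branch c v| /\
    (x = iter d.+1 (next c) v \/ x = iter d.+1 (prev c) v).

(** Vertices of the cycle or of a branch thus project to a unique root on [c]. *)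
Lemma seg_inj (v v' w : G) : v \in c -> v' \in c ->
  w \in v |: branch c v -> w \in v' |: branch c v' -> v = v'.
Proof.
move=> vc v'c; rewrite !in_setU1 => /predU1P[->|wv] /predU1P[|wv'] //.
- by move: (branch_off wv'); rewrite vc.
- by move=> def_w; move: (branch_off wv); rewrite def_w v'c.
- exact: branch_inj wv wv'.
Qed.

(** * Long paths that avoid a vertex of the cycle *)

Section LongPath.
Variables (x : G) (p : seq G).
Hypotheses (xc : x \in c) (p_sorted : sorted (@adj G) p) (p_uniq : uniq p).
Hypotheses (xp : x \notin p) (p_long : size c <= size p).

(** Rotating [c] to start at [x] turns its cyclic order into the linear order [idx]; a path avoiding
    [x] moves along [c] by unit steps of [idx]. *)
Let rc : seq G := rot (index x c) c.
Let idx (v : G) : nat := index v rc.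

Lemma rot_head : exists q : seq G, rc = x :: q.
Proof. by exists (drop (index x c).+1 c ++ take (index x c) c); rewrite /rc rot_index. Qed.

Let rc_uniq : uniq rc. Proof. by rewrite rot_uniq. Qed.
Let size_rc : size rc = size c. Proof. exact: size_rot. Qed.

Lemma next_rc (k : nat) : k < size c ->
  next c (nth x rc k) = if k.+1 < size c then nth x rc k.+1 else x.
Proof.
move=> kc; rewrite -(next_rot (index x c) c_uniq) -/rc next_nth mem_nth ?size_rc //.
rewrite index_uniq ?size_rc //; have [q def_rc] := rot_head.
rewrite def_rc -size_rc def_rc /= ltnS; case: ltnP => // qk.
by rewrite nth_default.
Qed.

Lemma idx_lt (v : G) : v \in c -> idx v < size c.
Proof. by move=> vc; rewrite -size_rc index_mem mem_rot. Qed.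

Lemma nth_idx (v : G) : v \in c -> nth x rc (idx v) = v.
Proof. by move=> vc; rewrite nth_index ?mem_rot. Qed.

Lemma idx_gt0 (v : G) : v != x -> 0 < idx v.
Proof.
by have [q def_rc] := rot_head; rewrite /idx def_rc /= eq_sym => /negPf->.
Qed.

Lemma idx_next (v : G) : v \in c -> next c v != x -> idx (next c v) = (idx v).+1.
Proof.
move=> vc; rewrite -{1 2}(nth_idx vc) next_rc ?idx_lt //.
by case: ifP => [lt_v _|_ /eqP//]; rewrite /idx index_uniq ?size_rc.
Qed.

Lemma idx_adj (u v : G) : u \in c -> v \in c -> u != x -> v != x -> adj u v ->
  idx v = (idx u).+1 \/ idx u = (idx v).+1.
Proof.
move=> uc vc ux vx uv.
have neq_uv : u != v by apply: contraTneq uv => ->; rewrite adj_irrefl.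
have [] := @no_ear u v [::] uc vc neq_uv; rewrite //= ?uv // => _ [def_v|def_u].
  by left; rewrite def_v idx_next // -def_v.
by right; rewrite def_u idx_next // -def_u.
Qed.

Lemma iter_next (k : nat) : k < size c -> iter k (next c) x = nth x rc k.
Proof.
elim: k => [_|k IHk kc]; first by have [q ->] := rot_head.
by rewrite iterS IHk ?next_rc ?kc //; apply: ltnW.
Qed.

Lemma iter_next_idx (v : G) : v \in c -> iter (idx v) (next c) x = v.
Proof. by move=> vc; rewrite iter_next ?idx_lt // nth_idx. Qed.

Lemma iter_prev_idx (v : G) : v \in c -> x = iter (idx v) (prev c) v.
Proof.
move=> vc; rewrite -{2}(iter_next_idx vc).
by elim: (idx v) => // k IHk; rewrite iterSr [iter k.+1 _ x]iterS prev_next.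
Qed.

Lemma iter_next_compl (v : G) : v \in c -> x = iter (size c - idx v) (next c) v.
Proof.
move=> vc; rewrite -{2}(iter_next_idx vc) -iterD subnK ?(ltnW (idx_lt vc)) //.
by rewrite -[size c]prednK ?(ltnW (ltnW c_gt2)) // iterS iter_next ?next_rc ?prednK ?ltnn //;
  rewrite (ltnW (ltnW c_gt2)).
Qed.

(** Otherwise [p] and [c] would be disjoint, with at least [2 * size c > n] vertices together. *)
Lemma path_meets : exists2 t, t \in p & t \in c.
Proof.
have [pc|/allPn[t tp /negbNE tc]] := boolP (all [predC c] p); last by exists t.
by exfalso; have := size_off_cycle p_uniq pc; move: p_long c_long; lia.
Qed.

Lemma path_seg (w : G) : w \in p ->
  exists v, [/\ v \in c, v \in p & w \in v |: branch c v].
Proof.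
move=> wp; have [wc|wc] := boolP (w \in c); first by exists w; rewrite setU11.
have [/existsP[v /andP[vp wv]]|none] := boolP [exists v, (v \in p) && (w \in branch c v)].
  by exists v; rewrite (branch_mem wv) vp in_setU1 wv orbT.
exfalso; have [t tp tc] := path_meets.
(* If no vertex of [p] carried [w], then [p] could never leave the component of [w] off [c],
   although it meets [c]. *)
suff /(_ t tp) : {subset p <= [set u | (u \notin c) && connect (off_adj c) w u]}.
  by rewrite inE tc.
apply: (sorted_stay p_sorted wp) => [|a b]; rewrite !inE ?wc ?connect0 //.
case/andP=> ac wa ab bp; have [bc|bc] := boolP (b \in c); last first.
  by apply: connect_trans wa (connect1 _); rewrite /off_adj ab ac bc.
case/existsP: none; exists b; rewrite bp inE bc; apply/existsP; exists a.
by rewrite ac adj_sym ab off_connect_sym.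
Qed.

(** This is [sorted_exit] for the vertices of [A] on [c] taken with their branches: by
    [branch_step], [p] can leave that set only along an edge between two vertices of [c]. *)
Lemma path_exit (A : pred G) (z w : G) : z \in c -> ~~ A z ->
  (forall a b, a \in c -> b \in c -> a != x -> b != x -> A a -> ~~ A b ->
     adj a b -> b = z) ->
  w \in p -> w \in c -> A w ->
  exists v, [/\ v \in c, A v & (head x p \in v |: branch c v) || (last x p \in v |: branch c v)].
Proof.
move=> zc Az gate wp wc Aw.
have neq_x a : a \in p -> a != x by apply: contraTneq => ->.
pose S := [set u | [exists v, [&& v \in c, v != x, A v & u \in v |: branch c v]]].
have := @sorted_exit G S z w x p p_sorted p_uniq wp.
case/(_ _ _ _)/orP => [|||/[!inE]/existsP[v]|/[!inE]/existsP[v]].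
- by rewrite inE; apply/existsP; exists w; rewrite wc neq_x // Aw setU11.
- rewrite inE; apply/existsP => -[v /and4P[vc _ Av zv]].
  by have := seg_inj vc zc zv (setU11 _ _) => def_v; rewrite -def_v Av in Az.
- move=> a b /[!inE] /existsP[v /and4P[vc vx Av av]] ab bp nSb.
  have bS u : u \in c -> u != x -> A u -> b \notin u |: branch c u.
    move=> uc ux Au; apply: contra nSb => bu; apply/existsP; exists u.
    by rewrite uc ux Au bu.
  move: av; rewrite in_setU1 => /predU1P[def_a|av]; last first.
    have := bS v vc vx Av; rewrite in_setU1.
    by have [->|->] := branch_step av ab; rewrite ?eqxx ?orbT.
  rewrite def_a in ab; have [bc|bc] := boolP (b \in c); last first.
    by have := bS v vc vx Av; rewrite in_setU1 (branch_nbr vc bc ab) orbT.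
  apply: gate ab => //; first exact: neq_x.
  by apply/negP => Ab; have := bS b bc (neq_x b bp) Ab; rewrite setU11.
- by case/and4P=> vc _ Av hv; exists v; rewrite vc Av hv.
- by case/and4P=> vc _ Av hv; exists v; rewrite vc Av hv orbT.
Qed.

(** The ends confine [p]: on [c] it stays between [v] and [w], off [c] in their two branches. Having
    [size c] vertices or more, it forces one branch to be at least as large as the distance from its
    root to [x] along the arc that [p] misses. *)
Lemma path_marks_ordered (v w : G) :
  v \in c -> v != x -> w \in c -> w != x ->
  head x p \in v |: branch c v -> last x p \in w |: branch c w ->
  idx v <= idx w -> marked x.
Proof.
move=> vc vx wc wx hv lw le_vw.
have neq_x a : a \in p -> a != x by apply: contraTneq => ->.
have sub : {subset p <= enum (branch c v) ++
   (if v == w then [:: v]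
    else enum (branch c w) ++ take (idx w - idx v).+1 (drop (idx v) rc))}.
  move=> a ap; rewrite mem_cat mem_enum.
  have [ac|ac] := boolP (a \in c).
    (* A vertex of [p] before [v] would force an end of [p] before [v], the only gate; yet both ends
       project to [v] or later. *)
    have ge_v : idx v <= idx a.
      rewrite leqNgt; apply/negP => lt_a.
      have [||u [uc lt_u /orP[hu|lu]]] :=
        @path_exit [pred u | idx u < idx v] v a vc _ _ ap ac lt_a.
      - by rewrite /= ltnn.
      - move=> b d bc dc bx dx /= lt_b; rewrite -leqNgt => ge_d bd.
        have [def_d|def_b] := idx_adj bc dc bx dx bd; last first.
          by rewrite def_b ltnNge (leqW ge_d) in lt_b.
        have eq_dv : idx d = idx v by apply/eqP; rewrite eqn_leq ge_d andbT def_d.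
        by rewrite -(nth_idx dc) -(nth_idx vc) eq_dv.
      - by have def_u := seg_inj uc vc hu hv; rewrite /= def_u ltnn in lt_u.
      - have def_u := seg_inj uc wc lu lw; rewrite /= def_u in lt_u.
        by move: lt_u; rewrite ltnNge le_vw.
    have le_w : idx a <= idx w.
      rewrite leqNgt; apply/negP => lt_a.
      have [||u [uc lt_u /orP[hu|lu]]] :=
        @path_exit [pred u | idx w < idx u] w a wc _ _ ap ac lt_a.
      - by rewrite /= ltnn.
      - move=> b d bc dc bx dx /= lt_b; rewrite -leqNgt => ge_d bd.
        have [def_d|def_b] := idx_adj bc dc bx dx bd.
          by move: lt_b; rewrite ltnNge ltnW // -def_d.
        have eq_dw : idx d = idx w by apply/eqP; rewrite eqn_leq ge_d /= -ltnS -def_b.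
        by rewrite -(nth_idx dc) -(nth_idx wc) eq_dw.
      - have def_u := seg_inj uc vc hu hv; rewrite /= def_u in lt_u.
        by move: lt_u; rewrite ltnNge le_vw.
      - by have def_u := seg_inj uc wc lu lw; rewrite /= def_u ltnn in lt_u.
    have [eq_vw|neq_vw] := eqVneq v w.
      have eq_av : idx a = idx v by apply/eqP; rewrite eqn_leq ge_v andbT eq_vw.
      have def_a : a = v by rewrite -(nth_idx ac) eq_av nth_idx.
      by rewrite def_a mem_head orbT.
    rewrite mem_cat; apply/orP; right; apply/orP; right.
    rewrite -(nth_idx ac) -[idx a](subnKC ge_v) -nth_drop.
    rewrite -(@nth_take (idx w - idx v).+1) ?ltnS ?leq_sub2r //.
    apply: mem_nth; rewrite size_take size_drop size_rc.
    move: ge_v le_w (idx_lt ac) (idx_lt wc); clear.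
    by move: (idx a) (idx v) (idx w) => i j k; case: ifP; lia.
  (* The root is the only gate of a branch, so a path that enters the branch has an end in it. *)
  have [u [uc up au]] := path_seg ap.
  move: au; rewrite in_setU1 => /predU1P[def_a|au]; first by rewrite def_a uc in ac.
  have := @sorted_exit G (branch c u) u a x p p_sorted p_uniq ap au.
  case/(_ _ _)/orP => [||hu|lu].
  - by apply/negP => /branch_off; rewrite uc.
  - by move=> b d bu bd _ nd; have [du|//] := branch_step bu bd; rewrite du in nd.
  - have -> : v = u by apply: (seg_inj vc uc hv); rewrite in_setU1 hu orbT.
    by rewrite au.
  - have -> : w = u by apply: (seg_inj wc uc lw); rewrite in_setU1 lu orbT.
    by case: eqP => [->|_]; rewrite ?mem_cat ?mem_enum au ?orbT.
have size_enum u : size (enum (branch c u)) = #|branch c u| by rewrite -cardE.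
have := uniq_leq_size p_uniq sub; rewrite size_cat size_enum => le_p.
have v0 := idx_gt0 vx; have := idx_lt vc; have := idx_lt wc => wg vg.
(* If both inequalities failed, the two branches and the arc from [v] to [w] would have at most
   [size c - 1] vertices in all. *)
have : idx v <= #|branch c v| \/ size c - idx w <= #|branch c w|.
  move: le_p; case: eqVneq => [_ /=|_].
    move: p_long v0 vg; clear; move: (idx v) (idx w) => i j; lia.
  rewrite size_cat size_enum size_take size_drop size_rc.
  move: p_long v0 vg wg le_vw; clear; move: (idx v) (idx w) => i j.
  move: #|branch c v| #|branch c w| (size c) (size p) => k l g s.
  by case: ifP; lia.
case=> [le_v|le_w].
  exists v, (idx v).-1; rewrite prednK //; split=> //.
  by right; apply: iter_prev_idx.
exists w, (size c - idx w).-1; rewrite prednK ?subn_gt0 //; split=> //.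
by left; apply: iter_next_compl.
Qed.

End LongPath.

Lemma path_marks (x : G) (p : seq G) :
  x \in c -> sorted (@adj G) p -> uniq p -> x \notin p -> size c <= size p ->
  marked x.
Proof.
move=> xc p_sorted p_uniq xp p_long.
have neq_x a : a \in p -> a != x by apply: contraTneq => ->.
have p_gt0 : 0 < size p by apply: leq_trans p_long; apply: leq_trans c_gt2.
have hp : head x p \in p by case: (p) p_gt0 => //= a s; rewrite mem_head.
have lp : last x p \in p by case: (p) p_gt0 => //= a s; rewrite mem_last.
have [v [vc vp hv]] := path_seg xc p_sorted p_uniq xp p_long hp.
have [w [wc wp lw]] := path_seg xc p_sorted p_uniq xp p_long lp.
pose idx u := index u (rot (index x c) c).
have [le_vw|/ltnW le_wv] := leqP (idx v) (idx w).
  exact: (path_marks_ordered xc p_sorted p_uniq xp p_long vc (neq_x _ vp)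
            wc (neq_x _ wp) hv lw le_vw).
have heads (s : seq G) : head x (rev s) = last x s.
  by case/lastP: s => // s a; rewrite rev_rcons last_rcons.
(* Reversing [p] exchanges its ends and restores the order assumed above. *)
apply: (@path_marks_ordered x (rev p) xc _ _ _ _ w v) => //.
- exact: rev_sorted_adj.
- by rewrite rev_uniq.
- by rewrite mem_rev.
- by rewrite size_rev.
- exact: neq_x.
- exact: neq_x.
- by rewrite heads.
- by rewrite -heads revK.
Qed.

(** Each [v] marks at most [#|branch c v|] vertices in each of the two directions. *)
Lemma card_marked (X : {set G}) :
  (forall x, x \in X -> marked x) -> #|X| + 2 * size c <= 2 * n.
Proof.
move=> X_marked.
pose M v := [set iter d.+1 (next c) v | d : 'I_#|branch c v|] :|:
            [set iter d.+1 (prev c) v | d : 'I_#|branch c v|].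
have subX : X \subset \bigcup_v M v.
  apply/subsetP=> x /X_marked[v [d [lt_d def_x]]].
  apply/bigcupP; exists v => //; rewrite inE.
  by case: def_x => ->; apply/orP; [left|right]; apply/imsetP; exists (Ordinal lt_d).
have card_M v : #|M v| <= 2 * #|branch c v|.
  apply: leq_trans (leq_card_setU _ _) _; rewrite mul2n -addnn.
  by apply: leq_add; apply: leq_trans (leq_imset_card _ _) _; rewrite card_ord.
have : #|\bigcup_v M v| <= \sum_v #|M v|.
  elim/big_ind2: _ => [|A a B b leA leB|//]; first by rewrite cards0.
  by apply: leq_trans (leq_card_setU _ _) _; apply: leq_add.
have : \sum_v #|M v| <= 2 * \sum_v #|branch c v|.
  by rewrite big_distrr; apply: leq_sum.
have := subset_leq_card subX; have := sum_branch.
by lia.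
Qed.

End ShortestCycle.

(** * Isomorphisms between cards *)

(** Vertex deletion as a relation on all of [G], so that paths and components of a card need no
    subtype. *)
Definition del_adj_rel (G : sgraph) (v : G) : rel G :=
  fun u w => [&& adj u w, u != v & w != v].

(** One direction of an isomorphism of cards, as total functions that may take any value at the
    deleted vertex. *)
Definition card_map (G H : sgraph) (x : G) (y : H) (f : G -> H) (g : H -> G) : Prop :=
  [/\ forall u, u != x -> f u != y, forall u, u != x -> g (f u) = u
    & forall u v, u != x -> v != x -> adj (f u) (f v) = adj u v].

Lemma card_mapP (G H : sgraph) (x : G) (y : H) :
  isomorphic (delete x) (delete y) ->
  exists f g, card_map x y f g /\ card_map y x g f.
Proof.
case/isomorphicP => f [g fK gK] f_adj.
have g_adj a b : adj (g a) (g b) = adj a b by rewrite -f_adj !gK.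
exists (fun u => if insub u is Some a then val (f a) else y).
exists (fun w => if insub w is Some a then val (g a) else x).
split; split=> [u ux|u ux|u v ux vx].
- rewrite (insubT (fun z => z != x) ux).
  exact: valP (f (Sub u ux)).
- by rewrite (insubT (fun z => z != x) ux) valK fK.
- by rewrite (insubT (fun z => z != x) ux) (insubT (fun z => z != x) vx); apply: f_adj.
- rewrite (insubT (fun z => z != y) ux).
  exact: valP (g (Sub u ux)).
- by rewrite (insubT (fun z => z != y) ux) valK gK.
- by rewrite (insubT (fun z => z != y) ux) (insubT (fun z => z != y) vx); apply: g_adj.
Qed.

Section CardMap.
Variables (G H : sgraph) (x : G) (y : H) (f : G -> H) (g : H -> G).
Hypothesis fP : card_map x y f g.

Lemma card_map_path (p : seq G) :
  sorted (@adj G) p -> uniq p -> x \notin p ->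
  [/\ sorted (@adj H) (map f p), uniq (map f p) & y \notin map f p].
Proof.
have [fx fK f_adj] := fP => sp up xp.
have px a : a \in p -> a != x by apply: contraTneq => ->.
split.
- apply: (homo_sorted_in (P := [pred a | a != x]) (e := @adj G)) => //.
    by move=> a b ax bx; rewrite f_adj.
  by apply/allP => a /px.
- by rewrite map_inj_in_uniq // => a b /px ax /px bx fab; rewrite -(fK a) // fab fK.
- by apply/mapP => -[a /px/fx + def_y]; rewrite -def_y eqxx.
Qed.

Lemma card_map_cycle (d : seq G) : is_cycle d -> x \notin d -> is_cycle (map f d).
Proof.
have [fx fK f_adj] := fP => /and3P[d2 cd ud] xd.
have dx a : a \in d -> a != x by apply: contraTneq => ->.
apply/and3P; split; rewrite ?size_map //.
  apply: (homo_cycle_in (P := [pred a | a != x]) (e := @adj G)) => //.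
    by move=> a b ax bx; rewrite f_adj.
  by apply/allP => a /dx.
by rewrite map_inj_in_uniq // => a b /dx ax /dx bx fab; rewrite -(fK a) // fab fK.
Qed.

Lemma card_map_connect (u w : G) : u != x ->
  connect (del_adj_rel x) u w -> connect (del_adj_rel y) (f u) (f w).
Proof.
have [fx fK f_adj] := fP => ux /connectP[s us ->].
elim: s u us ux => //= a s IHs u /andP[/and3P[ua ux ax] /IHs/(_ ax) fs] _.
apply: connect_trans fs; apply: connect1.
by rewrite /del_adj_rel f_adj ?ua ?fx.
Qed.

Lemma card_map_arcs :
  #|[set e : G * G | [&& adj e.1 e.2, e.1 != x & e.2 != x]]| <=
  #|[set e : H * H | [&& adj e.1 e.2, e.1 != y & e.2 != y]]|.
Proof.
have [fx fK f_adj] := fP.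
rewrite -(card_in_imset (f := fun e => (f e.1, f e.2))); last first.
  move=> [a b] [a' b'] /[!inE] /and3P[_ /= ax bx] /and3P[_ /= a'x b'x] [fa fb].
  by rewrite -(fK a) // fa fK // -(fK b) // fb fK.
apply/subset_leq_card/subsetP => _ /imsetP[[a b] /[!inE] /and3P[/= ab ax bx] ->].
by rewrite /= f_adj // ab !fx.
Qed.

End CardMap.

(** * Edge counting *)

(** Edges are counted as ordered pairs; those leaving [x] and those entering [x] are disjoint since
    there are no loops. *)
Lemma card_arcs (G : sgraph) (x : G) :
  #|[set e : G * G | adj e.1 e.2]| =
  #|[set e : G * G | [&& adj e.1 e.2, e.1 != x & e.2 != x]]| + (degree x).*2.
Proof.
pose out := [set e : G * G | adj e.1 e.2 && (e.1 == x)].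
pose inn := [set e : G * G | adj e.1 e.2 && (e.2 == x)].
have card_out : #|out| = degree x.
  have pair_inj : injective (pair x : G -> G * G) by move=> ? ? [].
  apply: etrans (card_imset [set u | adj x u] pair_inj).
  apply: eq_card => -[a b]; rewrite !inE /=; apply/andP/imsetP.
    by case=> ab /eqP def_a; exists b; rewrite ?inE -def_a.
  by case=> u /[!inE] xu [-> ->].
have card_inn : #|inn| = degree x.
  have pair_inj : injective (pair^~ x : G -> G * G) by move=> ? ? [].
  apply: etrans (card_imset [set u | adj x u] pair_inj).
  apply: eq_card => -[a b]; rewrite !inE /=; apply/andP/imsetP.
    by case=> ab /eqP def_b; exists a; rewrite ?inE -def_b // adj_sym.
  by case=> u /[!inE] xu [-> ->]; rewrite adj_sym.
have dis : out :&: inn = set0.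
  apply/setP => -[a b]; rewrite !inE /=; apply/negP.
  by case/andP=> /andP[ab /eqP def_a] /andP[_ /eqP def_b]; rewrite def_a def_b adj_irrefl in ab.
have card_io : #|out :|: inn| = (degree x).*2.
  by rewrite cardsU dis cards0 subn0 card_out card_inn addnn.
rewrite -(cardsID (out :|: inn)) addnC -card_io; congr (_ + _); apply: eq_card => e.
  by rewrite !inE; case: (adj _ _); case: (_ == x); case: (_ == x).
by rewrite !inE; case: (adj _ _); case: (_ == x); case: (_ == x).
Qed.

(** Isomorphic cards have equally many edges, so the difference of the degrees depends only on [G]
    and [H]. *)
Lemma degree_card (G H : sgraph) (x : G) (y : H) :
  isomorphic (delete x) (delete y) ->
  #|[set e : G * G | adj e.1 e.2]| + (degree y).*2 =
  #|[set e : H * H | adj e.1 e.2]| + (degree x).*2.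
Proof.
case/card_mapP => f [g [fP gP]].
rewrite (card_arcs x) (card_arcs y) addnAC; congr (_ + _ + _).
by apply/eqP; rewrite eqn_leq (card_map_arcs fP) (card_map_arcs gP).
Qed.

(** * Degrees along cycles and paths *)

(** The path is [d] cut open; a vertex is lost only if [v] lies on [d]. *)
Lemma cycle_path (G : sgraph) (d : seq G) (v : G) : is_cycle d ->
  exists p, [/\ sorted (@adj G) p, uniq p, v \notin p, size d <= (size p).+1
              & forall u, u \in d -> u != v -> u \in p].
Proof.
case/and3P=> d2 cd ud; have [vd|vd] := boolP (v \in d); last first.
  exists d; split=> //; case: (d) cd => //= a s.
  by rewrite rcons_path => /andP[].
case: (rot_to vd) => i p def_d; exists p.
move: cd ud d2; rewrite -(rot_cycle i) -(rot_uniq i) -(size_rot i) def_d /=.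
rewrite rcons_path => /andP[/path_sorted sp _] /andP[vp up] _.
by split=> // u ud uv; rewrite -(mem_rot i) def_d inE (negPf uv) in ud.
Qed.

Lemma cycle_nbrs (G : sgraph) (d : seq G) (v : G) : is_cycle d -> v \in d ->
  exists a b, [/\ a \in d, b \in d, a != b, adj v a & adj v b].
Proof.
case/and3P=> d2 cd ud vd; case: (rot_to vd) => i p def_d.
move: cd ud d2; rewrite -(rot_cycle i) -(rot_uniq i) -(size_rot i) def_d /=.
have mem_d u : u \in p -> u \in d.
  by move=> up; rewrite -(mem_rot i) def_d inE up orbT.
case: p {def_d} mem_d => [|a [|b s]] //= mem_d; rewrite rcons_path /=.
case/andP=> va /andP[_ /andP[_ last_v]] /and3P[_ /norP[ab a_s] _] _.
rewrite adj_sym in last_v; exists a, (last b s); split=> //.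
- by apply: mem_d; rewrite mem_head.
- by apply: mem_d; rewrite inE mem_last orbT.
- by apply: contraTneq (mem_last b s) => <-; rewrite inE negb_or ab.
Qed.

Lemma cycle_degree (G : sgraph) (d : seq G) (v : G) :
  is_cycle d -> v \in d -> 1 < degree v.
Proof.
move=> cd /(cycle_nbrs cd)[a [b [_ _ ab va vb]]].
have <- : #|[set a; b]| = 2 by rewrite cards2 ab.
apply: subset_leq_card; apply/subsetP => u.
by rewrite !inE => /orP[] /eqP->.
Qed.

Lemma degree2_nbr (G : sgraph) (d : seq G) (v w : G) :
  is_cycle d -> v \in d -> degree v = 2 -> adj v w -> w \in d.
Proof.
move=> cd /(cycle_nbrs cd)[a [b [ad bd ab va vb]]] deg_v vw.
have /eqP nbrs : [set a; b] == [set u | adj v u].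
  rewrite eqEcard; apply/andP; split; last by rewrite -/(degree v) deg_v cards2 ab.
  by apply/subsetP => u; rewrite !inE => /orP[] /eqP->.
have : w \in [set a; b] by rewrite nbrs inE.
by rewrite !inE => /orP[] /eqP->.
Qed.

Lemma inner_degree (G : sgraph) (a b v : G) (s : seq G) :
  sorted (@adj G) (a :: rcons s b) -> uniq (a :: rcons s b) -> v \in s ->
  1 < degree v.
Proof.
move=> sp up vs; case: (splitPr vs) => s1 s2 in sp up *.
have : path (@adj G) a (rcons (s1 ++ v :: s2) b) := sp.
rewrite rcons_cat rcons_cons cat_path => /and3P[_ l_v v_r].
have : uniq ((a :: s1) ++ v :: rcons s2 b) by move: up; rewrite rcons_cat.
rewrite cat_uniq => /and3P[_ /hasPn dis _].
have def_r : head b s2 \in rcons s2 b by case: (s2) => [|r t] /=; rewrite inE eqxx.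
have v_h : adj v (head b s2) by case: (s2) v_r => [|r t] /= /andP[].
have neq_lr : last a s1 != head b s2.
  apply: contraTneq (mem_last a s1) => ->.
  by apply: dis; rewrite inE def_r orbT.
have <- : #|[set last a s1; head b s2]| = 2 by rewrite cards2 neq_lr.
apply: subset_leq_card; apply/subsetP => u.
by rewrite !inE => /orP[] /eqP-> //; rewrite adj_sym.
Qed.

(** * Components after deleting a vertex *)

Section Component.
Variables (G : sgraph) (v : G).

Definition comp_del (u : G) : {set G} := [set w | connect (del_adj_rel v) u w].

Lemma del_connect_sym : connect_sym (del_adj_rel v).
Proof.
by apply: sym_connect_sym => u w; rewrite /del_adj_rel adj_sym [(u != v) && _]andbC.
Qed.

Lemma del_path_neq (u : G) (s : seq G) :
  path (del_adj_rel v) u s -> u != v -> v \notin u :: s.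
Proof.
rewrite inE negb_or eq_sym => us ->; elim: s u us => //= a s IHs u.
by case/andP=> /and3P[_ _ av] /IHs; rewrite inE negb_or eq_sym av.
Qed.

Lemma comp_del_neq (u : G) : u != v -> v \notin comp_del u.
Proof.
move=> uv; rewrite inE; apply/connectP => -[s us def_v].
by have := del_path_neq us uv; rewrite def_v mem_last.
Qed.

Lemma comp_del_closed (u a b : G) :
  u != v -> a \in comp_del u -> adj a b -> b != v -> b \in comp_del u.
Proof.
move=> uv ua ab bv.
have av : a != v by apply: contraTneq ua => ->; apply: comp_del_neq.
move: ua; rewrite !inE => ua; apply: connect_trans ua (connect1 _).
by rewrite /del_adj_rel ab av.
Qed.

Lemma comp_del_path (u a b : G) :
  a \in comp_del u -> b \in comp_del u ->
  exists s, [/\ path (@adj G) a s, uniq (a :: s), b = last a s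
              & {subset s <= comp_del u}].
Proof.
rewrite !inE => ua ub; have /connectP[s sp def_b] : connect (del_adj_rel v) a b.
  by apply: connect_trans ub; rewrite del_connect_sym.
case: (shortenP sp) => t tp ut _ in def_b *; exists t; split=> //.
  by apply: sub_path tp => c d /and3P[].
by move=> w wt; rewrite inE (connect_trans ua) // (path_connect tp) // inE wt orbT.
Qed.

End Component.

Lemma card_map_comp (G H : sgraph) (x u : G) (y : H) (f : G -> H) (g : H -> G) :
  card_map x y f g -> card_map y x g f -> u != x ->
  #|comp_del y (f u)| = #|comp_del x u|.
Proof.
have half (G' H' : sgraph) (x' u' : G') (y' : H') f' g' :
    card_map x' y' f' g' -> u' != x' ->
    #|comp_del x' u'| <= #|comp_del y' (f' u')|.
  move=> fP ux; have [fx fK _] := fP; rewrite -(card_in_imset (f := f')).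
    apply/subset_leq_card/subsetP => _ /imsetP[w /[!inE] uw ->].
    exact: (card_map_connect fP ux uw).
  have neq w : w \in comp_del x' u' -> w != x'.
    by apply: contraTneq => ->; apply: comp_del_neq.
  by move=> a b /neq ax /neq bx fab; rewrite -(fK a) // fab fK.
move=> fP gP ux; have [fx fK _] := fP; apply/eqP; rewrite eqn_leq.
by rewrite (half _ _ _ _ _ _ _ fP ux) andbT -{2}(fK u ux) (half _ _ _ _ _ _ _ gP) ?fx.
Qed.

(** * Common cards with a graph of larger girth *)

Section CommonCards.
Variables (G H : sgraph) (n m : nat) (x : 'I_m -> G) (y : 'I_m -> H) (c : seq G).
Hypotheses (card_G : #|G| = n) (card_H : #|H| = n).
Hypotheses (x_inj : injective x) (y_inj : injective y).
Hypothesis cards : forall i, isomorphic (delete (x i)) (delete (y i)).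
Hypothesis m_large : 2 * n + 3 <= 3 * m.
Hypothesis c_cycle : is_cycle c.
Hypothesis c_min : forall d : seq G, is_cycle d -> size c <= size d.
Hypothesis H_girth : forall d : seq H, is_cycle d -> size c < size d.

Let c_uniq : uniq c. Proof. by case/and3P: c_cycle. Qed.

(** Otherwise [c] survives in the card and is copied into [H], which has no cycle that short. *)
Lemma x_on_cycle (i : 'I_m) : x i \in c.
Proof.
apply/negPn/negP => xc; have [f [g [fP _]]] := card_mapP (cards i).
by have := H_girth (card_map_cycle fP c_cycle xc); rewrite size_map ltnn.
Qed.

Lemma codom_x_sub : {subset codom x <= c}.
Proof. by move=> _ /codomP[i ->]; apply: x_on_cycle. Qed.

Lemma m_le_cycle : m <= size c.
Proof.
have x_uniq : uniq (codom x) by apply/injectiveP.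
by have := uniq_leq_size x_uniq codom_x_sub; rewrite size_codom card_ord.
Qed.

Let c_long : 2 * n + 3 <= 3 * size c.
Proof. by have := m_le_cycle; move: m_large; lia. Qed.

(** A cycle of [H] minus [y i] contains a path on at least [size c] vertices; its copy in [G] avoids
    [x i], so every [x i] is marked. *)
Lemma H_acyclic (d : seq H) : ~~ is_cycle d.
Proof.
apply/negP => cd; have size_d := H_girth cd.
have x_marked v : v \in [set x i | i : 'I_m] -> marked c v.
  case/imsetP=> i _ ->; have [p [p_sorted p_uniq yp size_p _]] := cycle_path (y i) cd.
  have [f [g [_ gP]]] := card_mapP (cards i).
  have [gp_sorted gp_uniq xp] := card_map_path gP p_sorted p_uniq yp.
  apply: (path_marks card_G c_cycle c_min c_long (x_on_cycle i) gp_sorted gp_uniq xp).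
  by rewrite size_map -ltnS; apply: leq_trans size_p.
(* This gives [m + 2 * size c <= 2 * n], hence [3 * m <= 2 * n]. *)
have := card_marked card_G c_cycle c_min c_long x_marked.
by rewrite card_imset // card_ord; have := m_le_cycle; move: m_large; lia.
Qed.

Definition deg2 : {set 'I_m} := [set i | degree (x i) == 2].

(** Vertices of [c] have degree at least 2, and at most [n - size c] of them exceed it. *)
Lemma card_deg2 : m + size c <= #|deg2| + n.
Proof.
have := card_degree_gt2 card_G c_cycle c_min c_long.
have : #|~: deg2| <= #|[set v in c | 2 < degree v]|.
  rewrite -(card_imset _ x_inj); apply/subset_leq_card/subsetP => _ /imsetP[i i2 ->].
  rewrite !inE in i2 *; rewrite x_on_cycle ltn_neqAle eq_sym i2.
  exact: cycle_degree c_cycle (x_on_cycle i).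
by have := cardsC deg2; rewrite card_ord; lia.
Qed.

Lemma deg2_ex : exists i, i \in deg2.
Proof.
apply/set0Pn; rewrite -card_gt0.
by have := card_deg2; have := m_le_cycle; move: m_large; lia.
Qed.

Lemma degree_y (i j : 'I_m) : degree (y i) + degree (x j) = degree (y j) + degree (x i).
Proof.
have := degree_card (cards i); have := degree_card (cards j).
move: #|[set e : G * G | _]| #|[set e : H * H | _]| => a b; rewrite -!addnn; lia.
Qed.

(** * The case of small degrees in [H] *)

Section Leaves.
Hypothesis leaf : forall i, i \in deg2 -> degree (y i) <= 1.

(** Inner vertices of a path have degree at least 2, so only its two ends can be among the [y i]
    with [i] in [deg2]. *)
Lemma leaf_path (p : seq H) :
  sorted (@adj H) p -> uniq p -> #|deg2| + size p <= n + 2.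
Proof.
have card_Y : #|y @: deg2| = #|deg2| by rewrite card_imset.
have Y_max (s : seq H) : uniq s -> (forall v, v \in s -> 1 < degree v) ->
    #|deg2| + size s <= n.
  move=> us sdeg; rewrite -card_Y cardE -size_cat -card_H.
  have /card_uniqP <- : uniq (enum (y @: deg2) ++ s) by [
    rewrite cat_uniq enum_uniq us andbT; apply/hasPn => v /sdeg deg_v;
    rewrite mem_enum; apply: contraTN deg_v => /imsetP[i /leaf i2 ->];
    rewrite -leqNgt].
  exact: max_card.
have deg2_n : #|deg2| <= n by rewrite -[#|_|]addn0; apply: (Y_max [::]).
case: p => [|a p] sp up; first exact: leq_add deg2_n _.
case/lastP: p => [|s b] in sp up *; first exact: leq_add deg2_n _.
have us : uniq s by move: up; rewrite cons_uniq rcons_uniq => /and3P[].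
have := leq_add (Y_max s us (fun v => inner_degree sp up)) (leqnn 2).
by rewrite /= size_rcons -addnA addn2.
Qed.

Lemma no_leaves : False.
Proof.
have path_y i (p : seq G) : sorted (@adj G) p -> uniq p -> x i \notin p ->
    exists q : seq H, [/\ sorted (@adj H) q, uniq q, y i \notin q & size q = size p].
  move=> sp up xp; have [f [g [fP _]]] := card_mapP (cards i).
  have [sq uq yq] := card_map_path fP sp up xp.
  by exists (map f p); rewrite size_map.
have long_y i : exists q : seq H,
    [/\ sorted (@adj H) q, uniq q, y i \notin q & size c <= (size q).+1].
  have [p [sp up xp size_p _]] := cycle_path (x i) c_cycle.
  by have [q [sq uq yq def_q]] := path_y i p sp up xp; exists q; rewrite def_q.
have [i0 i0_2] := deg2_ex; have [q [sq uq y0q size_q]] := long_y i0.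
have q_max := leaf_path sq uq; have c2 := card_deg2; have mc := m_le_cycle.
(* As [q] has at least [size c - 1] vertices, [q_max] and [c2] give
   [m + 2 * size c <= 2 * n + 3 <= 3 * m]. *)
have eq_m : m = size c by move: m_large; lia.
have x_onto : c =i codom x.
  have x_uniq : uniq (codom x) by apply/injectiveP.
  have [] := uniq_min_size x_uniq codom_x_sub; first by rewrite size_codom card_ord eq_m.
  by move=> _ xE v; rewrite xE.
have [all2|] := eqVneq deg2 setT; last first.
  rewrite -subTset => /subsetPn[i _ i2].
  have deg_x : 2 < degree (x i).
    rewrite ltn_neqAle eq_sym (cycle_degree c_cycle (x_on_cycle i)) andbT.
    by move: i2; rewrite inE.
  have [w wc vw] := off_nbr card_G c_cycle c_min c_long (x_on_cycle i) deg_x.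
  have [k p def_c] := rot_to (x_on_cycle i).
  have : cycle (@adj G) (rot k c) by rewrite rot_cycle; case/and3P: c_cycle.
  have up : uniq (x i :: p) by rewrite -def_c rot_uniq.
  have size_p : (size p).+1 = size c by rewrite -(size_rot k c) def_c.
  have mem_p v : v \in x i :: p -> v \in c by rewrite -def_c mem_rot.
  rewrite def_c; case/lastP: p => [|s v] in up size_p mem_p def_c *.
    by have := c_cycle; rewrite /is_cycle -size_p.
  have vc : v \in c by apply: mem_p; rewrite inE mem_rcons mem_head orbT.
  have /codomP[j def_v] : v \in codom x by rewrite -x_onto.
  rewrite /= !rcons_path => /andP[/andP[xs _] _].
  (* The off-cycle neighbour [w] replaces the last vertex [v] of the opened cycle, which is [x j]:
     the path has [size c] vertices and avoids [x j]. Its copy in [H] is one vertex too long for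
     [leaf_path]. *)
  have [] := path_y j (w :: x i :: s).
  - by rewrite /= adj_sym vw.
  - rewrite /= in up *; move: up; rewrite mem_rcons rcons_uniq inE negb_or.
    case/and3P=> /andP[_ ->] _ ->; rewrite !andbT inE negb_or.
    apply/andP; split; first by apply: contraNneq wc => ->; apply: x_on_cycle.
    by apply: contra wc => ws; apply: mem_p; rewrite inE mem_rcons inE ws !orbT.
  - rewrite -def_v !inE !negb_or; apply/and3P; split.
    + by apply: contraNneq wc => <-.
    + by move: up; rewrite /= mem_rcons inE negb_or eq_sym => /andP[/andP[]].
    + by move: up; rewrite /= rcons_uniq => /and3P[].
  move=> r [sr ur _ size_r]; have := leaf_path sr ur.
  rewrite size_r /=; rewrite size_rcons in size_p.
  by move: m_large c2 size_p eq_m; clear; move: #|deg2| (size c) (size s) => a b d; lia.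
(* Now [#|deg2| = m], so [leaf_path] gives [2 * m <= n + 3]; with [m_large] only the triangle
   remains. *)
have m3 : m = n /\ n <= 3.
  have := leaf_path sq uq; rewrite all2 cardsT card_ord.
  by move: m_large eq_m size_q; have := max_card [in c]; have/card_uniqP -> := c_uniq; rewrite card_G; lia.
case: m3 => eq_mn n3.
have y_onto (v : H) : exists i, v = y i.
  have /codomP[i ->] : v \in codom y; last by exists i.
  by apply: inj_card_onto => //; rewrite card_ord card_H eq_mn.
have deg_H (v : H) : degree v <= 1.
  by have [i ->] := y_onto v; apply: leaf; rewrite all2.
have c3 : 2 < size c by case/and3P: c_cycle.
case: q => [|a [|b q]] in sq uq size_q {q_max y0q} *; rewrite /= in size_q; try by move: c3 size_q; lia.
have ab : adj a b by case/andP: sq.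
have [j def_b] := y_onto b; have [r [sr ur br size_r]] := long_y j.
rewrite -def_b in br.
case: r => [|d [|e r]] in sr ur size_r br *; rewrite /= in size_r; try by move: c3 size_r; lia.
have de : adj d e by case/andP: sr.
have neq_ab : a != b by apply: contraTneq ab => ->; rewrite adj_irrefl.
have neq_de : d != e by apply: contraTneq de => ->; rewrite adj_irrefl.
move: br; rewrite !inE !negb_or => /and3P[bd be _].
(* The edge [de] avoids [b]; on at most three vertices it must meet the edge [ab] in [a], which gets
   a second neighbour. *)
have [w aw bw] : exists2 w, adj a w & b != w.
  have [->|ad] := eqVneq a d; first by exists e.
  have [->|ae] := eqVneq a e; first by exists d; rewrite // adj_sym.
  have : size [:: a; b; d; e] <= #|H|.
    have /card_uniqP <- : uniq [:: a; b; d; e]; last exact: max_card.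
    by rewrite /= !inE !negb_or neq_ab ad ae bd be neq_de.
  by rewrite card_H => /leq_trans/(_ n3).
have := deg_H a; rewrite leqNgt => /negP[].
have <- : #|[set b; w]| = 2 by rewrite cards2 bw.
apply: subset_leq_card; apply/subsetP => u.
by rewrite !inE => /orP[] /eqP->.
Qed.

End Leaves.

(** * The case of degrees at least 2 in [H] *)

Section Cuts.
Hypothesis y_inner : forall i, 1 < degree (y i).

(** The vertex [b i] is the image of some vertex of [c] other than [x i], so its component has the
    size of the one containing the rest of [c] in the card of [G]. *)
Lemma y_components : exists b : 'I_m -> H, forall i,
  [/\ b i != y i, size c <= #|comp_del (y i) (b i)|.+1
    & forall j, j \in deg2 -> #|comp_del (y i) (b i)| <= #|comp_del (y j) (b j)|].
Proof.
pose on_c i v := [/\ v != x i, v \in c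
                 & forall u, u \in c -> u != x i -> u \in comp_del (x i) v].
have [a aP] : exists a : 'I_m -> G, forall i, on_c i (a i).
  apply: (@fin_all_exists _ (fun=> vertex G) on_c) => i.
  have [p [sp up xp size_p c_p]] := cycle_path (x i) c_cycle.
  have [a [_ [ac _ _ xa _]]] := cycle_nbrs c_cycle (x_on_cycle i).
  have neq_x u : u \in p -> u != x i by apply: contraTneq => ->.
  have ax : a != x i by apply: contraTneq xa => ->; rewrite adj_irrefl.
  exists a; split=> // u uc ux.
  have ap := c_p a ac ax; have up' := c_p u uc ux.
  suff /(_ u up') : {subset p <= comp_del (x i) a} by [].
  apply: (sorted_stay sp ap) => [|v w va vw wp]; first by rewrite inE connect0.
  exact: comp_del_closed va vw (neq_x w wp).
pose is_map i (fg : {ffun G -> H} * {ffun H -> G}) :=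
  card_map (x i) (y i) fg.1 fg.2 /\ card_map (y i) (x i) fg.2 fg.1.
have [fg fgP] : exists fg, forall i, is_map i (fg i).
  apply: (@fin_all_exists _ (fun=> ({ffun G -> H} * {ffun H -> G})%type) is_map) => i.
  have [f [g [[fx fK f_adj] [gy gK g_adj]]]] := card_mapP (cards i).
  by exists (finfun f, finfun g); split; split=> *; rewrite /= !ffunE; auto.
pose A i := comp_del (x i) (a i).
have card_B i : #|comp_del (y i) ((fg i).1 (a i))| = #|A i|.
  have [fP gP] := fgP i; have [ax _ _] := aP i; exact: card_map_comp fP gP ax.
have A_long i : size c <= #|A i|.+1.
  have [_ _ c_A] := aP i.
  have := cardsD1 (x i) [set u in c]; rewrite inE x_on_cycle cardsE.
  rewrite (card_uniqP c_uniq) add1n => ->; rewrite ltnS.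
  apply/subset_leq_card/subsetP => u; rewrite in_setD1 inE => /andP[ux uc].
  exact: c_A.
(* Let [U] be the component of [G] containing [c]. Always [A i] lies in [U :\ x i]; if [x j] has
   degree 2, its neighbours are on [c] and all of [U :\ x j] lies in [A j]. *)
have A_max i j : j \in deg2 -> #|A i| <= #|A j|.
  rewrite inE => /eqP j2; pose U := [set w | connect (@adj G) (a j) w].
  have [aj ajc c_A] := aP j; have [ai aic _] := aP i.
  have adj_csym : connect_sym (@adj G) by apply: sym_connect_sym; apply: adj_sym.
  have del_sub v : subrel (connect (del_adj_rel v)) (connect (@adj G)).
    by apply: connect_sub => u w /and3P[uw _ _]; apply: connect1.
  have cU u : u \in c -> u \in U.
    move=> uc; have [->|ux] := eqVneq u (x j); last first.
      by have := c_A u uc ux; rewrite !inE; apply: del_sub.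
    have [b [_ [bc _ _ xb _]]] := cycle_nbrs c_cycle (x_on_cycle j).
    have bx : b != x j by apply: contraTneq xb => ->; rewrite adj_irrefl.
    rewrite inE (connect_trans (y := b)) //; last by apply: connect1; rewrite adj_sym.
    by have := c_A b bc bx; rewrite inE; apply: del_sub.
  have subA : A i \subset U :\ x i.
    apply/subsetP => w wA; rewrite 2!inE; apply/andP; split.
      by apply: contraTneq wA => ->; apply: comp_del_neq.
    have := cU _ aic; move: wA; rewrite !inE => /del_sub aw ua.
    exact: connect_trans ua aw.
  have supA : U :\ x j \subset A j.
    apply/subsetP => w; rewrite 3!inE => /andP[wx /connectP[s us def_w]].
    suff : w \in x j |: A j by rewrite in_setU1 (negPf wx).
    have aS : a j \in x j |: A j by rewrite in_setU1 inE connect0 orbT.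
    have := mem_last (a j) s; rewrite -def_w inE => /predU1P[->//|].
    apply: (path_stay us) => // v u /[1!in_setU1] /predU1P[->|vA] vu _.
      have uc := degree2_nbr c_cycle (x_on_cycle j) j2 vu.
      by rewrite in_setU1; case: eqVneq => //= ux; apply: c_A.
    by rewrite in_setU1; case: eqVneq => //= ux; apply: comp_del_closed vA vu ux.
  have := subset_leq_card supA; apply: leq_trans.
  apply: leq_trans (subset_leq_card subA) _.
  have := cardsD1 (x i) U; have := cardsD1 (x j) U.
  by rewrite !cU ?x_on_cycle //= !add1n => -> [->].
exists (fun i => (fg i).1 (a i)) => i; rewrite card_B; split=> // [|j /A_max].
  by have [[fx _ _] _] := fgP i; have [ax _ _] := aP i; apply: fx.
by rewrite card_B.
Qed.

Lemma no_cuts : False.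
Proof.
have [b bP] := y_components; pose B i := comp_del (y i) (b i).
have yB i : y i \notin B i by have [by_ _ _] := bP i; apply: comp_del_neq.
have B_closed i u w : u \in B i -> adj u w -> w != y i -> w \in B i.
  by have [by_ _ _] := bP i; apply: comp_del_closed.
have B_long i : size c <= #|B i|.+1 by have [] := bP i.
have B_max i j : j \in deg2 -> #|B i| <= #|B j| by have [_ _] := bP i; apply.
(* Two sets of at least [size c - 1] vertices are too large to be disjoint. *)
have B_meet i j : exists t, (t \in B i) && (t \in B j).
  have [t] : exists t, t \in B i :&: B j; last by rewrite inE; exists t.
  apply/set0Pn; rewrite -card_gt0.
  have := cardsUI (B i) (B j); have : #|B i :|: B j| <= n by rewrite -card_H max_card.
  have := B_long i; have := B_long j; move: c_long.
  have [] : 2 < size c by case/and3P: c_cycle.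
  move: #|B i| #|B j| #|B i :|: B j| #|B i :&: B j| (size c) => k1 k2 k3 k4 g; lia.
(* Missing [y j], the connected set [B i] lies in one component of [H - y j], which is [B j] as the
   two meet. *)
have B_sub i j : y j \notin B i -> B i \subset B j.
  move=> yjB; apply/subsetP => w wi; have [t /andP[ti tj]] := B_meet i j.
  have [s [ts _ def_w sB]] := comp_del_path ti wi.
  have := mem_last t s; rewrite -def_w inE => /predU1P[->//|].
  apply: (path_stay ts tj) => u v uj uv vs; apply: B_closed uv _ => //.
  by apply: contraNneq yjB => <-; apply: sB.
have [i0 i0_2] := deg2_ex; have c2 := card_deg2; have mc := m_le_cycle.
(* Otherwise [B i] is a component of [H], and by maximality it equals every [B j] with [j] in
   [deg2]. It then misses all those [y j], so [#|deg2| + size c - 1 <= n], which is too small. *)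
have near i : i \in deg2 -> exists2 w, w \in B i & adj (y i) w.
  move=> i2; apply/exists_inP; rewrite -[[exists _ in _, _]]negbK negb_exists_in.
  apply/negP => /forall_inP far.
  have stay u w : u \in B i -> adj u w -> w \in B i.
    move=> uB uw; apply: (B_closed _ _ _ uB uw); apply: contraTneq uw => ->.
    by rewrite adj_sym; apply: far.
  have B_eq j : j \in deg2 -> B j = B i.
    move=> j2; apply/eqP; rewrite eqEcard B_max // andbT; apply/subsetP => w wj.
    have [t /andP[ti tj]] := B_meet i j.
    have [s [ts _ def_w _]] := comp_del_path tj wj.
    have := mem_last t s; rewrite -def_w inE => /predU1P[->//|].
    by apply: (path_stay ts ti) => u v ui uv _; apply: stay uv.
  have : #|y @: deg2 :|: B i| <= n by rewrite -card_H max_card.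
  rewrite cardsU (_ : _ :&: _ = set0) ?cards0 ?subn0 ?card_imset //; last first.
    apply/setP => w; rewrite in_setI in_set0; apply/andP => -[/imsetP[j j2 ->]].
    by rewrite -(B_eq j j2); apply/negP.
  have := B_long i; move: c2 mc m_large; clear.
  move: #|deg2| (size c) #|B i| => k g l; lia.
(* Otherwise [B j] contains [B i], and also [y i] through a neighbour of [y i] in [B i], against the
   maximality of [B i]. *)
have y_in i j : i \in deg2 -> j != i -> y j \in B i.
  move=> i2 ji; apply/negPn/negP => yjB; have sub := B_sub i j yjB.
  have [w wi yw] := near i i2.
  have yiB : y i \in B j.
    apply: (B_closed j w); first exact: (subsetP sub).
      by rewrite adj_sym.
    by rewrite (inj_eq y_inj) eq_sym.
  have : #|y i |: B i| <= #|B j|.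
    by apply: subset_leq_card; rewrite subUset sub1set yiB.
  by rewrite cardsU1 yB add1n ltnNge B_max.
(* Two neighbours of [y i] inside [B i] would be joined by a path in [B i], closing a cycle through
   [y i]. *)
have [z zP] : exists z : 'I_m -> H, forall i, adj (y i) (z i) /\ z i \notin B i.
  apply: (@fin_all_exists _ (fun=> vertex H) (fun i z => adj (y i) z /\ z \notin B i)) => i.
  suff /subsetPn[z] : ~~ ([set u | adj (y i) u] \subset B i) by rewrite inE => *; exists z.
  apply/negP => /subsetP nbrs.
  have /card_gt1P[u [v [+ + uv]]] := y_inner i.
  move=> yu yv; have [s [us uniq_s def_v sB]] := comp_del_path (nbrs u yu) (nbrs v yv).
  have := H_acyclic (y i :: u :: s); rewrite /is_cycle /= => /negP[].
  rewrite inE in yu; rewrite inE adj_sym in yv.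
  case: s => [|w s] in us uniq_s def_v sB *; first by rewrite def_v eqxx in uv.
  apply/and3P; split=> //.
    have us_y : path (@adj H) u (rcons (w :: s) (y i)) by rewrite rcons_path us -def_v.
    by rewrite /= yu.
  rewrite cons_uniq uniq_s andbT inE negb_or; apply/andP; split.
    by apply: contraTneq yu => ->; rewrite adj_irrefl.
  by apply/negP => /sB; apply/negP.
have z_Y i j : i \in deg2 -> z i != y j.
  move=> i2; have [yz zB] := zP i; have [->|ji] := eqVneq j i.
    by apply: contraTneq yz => ->; rewrite adj_irrefl.
  by apply: contraNneq zB => ->; apply: y_in.
(* If [z i = z j], then [y j], which lies in [B i], has the neighbour [z i], and this puts [z i]
   into [B i]. *)
have z_inj : {in deg2 &, injective z}.
  move=> i j i2 j2 eq_z; apply/eqP/negPn/negP => ij.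
  have [_ /negP[]] := zP i; have [yz _] := zP j.
  apply: (B_closed i (y j)); [by rewrite y_in // eq_sym | by rewrite eq_z |].
  exact: z_Y.
(* Disjointness gives [m + #|deg2| <= n], hence [2 * m + size c <= 2 * n], against [m_large]. *)
have : #|y @: [set: 'I_m] :|: z @: deg2| <= n by rewrite -card_H max_card.
rewrite cardsU (_ : _ :&: _ = set0) ?cards0 ?subn0; last first.
  apply/setP => w; rewrite !inE; apply/andP => -[/imsetP[j _ ->]].
  by case/imsetP=> i i2 def_z; have := z_Y i j i2; rewrite def_z eqxx.
rewrite card_imset // card_in_imset // cardsT card_ord.
move: c2 mc m_large; clear; move: #|deg2| (size c) => k g; lia.
Qed.

End Cuts.

(** * Combining the cases and exchanging the two graphs *)

(** By [degree_y] all [y i] with [i] in [deg2] have the same degree, and no other [y j] has a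
    smaller one since [x j] has degree at least 2. So one value decides between the two cases. *)
Lemma cards_impossible : False.
Proof.
have [i0 i0_2] := deg2_ex; have := i0_2; rewrite inE => /eqP deg_x0.
have [le1|gt1] := leqP (degree (y i0)) 1.
  apply: no_leaves => i /[!inE] /eqP deg_xi; have := degree_y i i0.
  by rewrite deg_xi deg_x0 => /eqP; rewrite eqn_add2r => /eqP ->.
apply: no_cuts => i; have := degree_y i i0.
rewrite deg_x0; have := cycle_degree c_cycle (x_on_cycle i).
by move: gt1; lia.
Qed.

End CommonCards.

Lemma isomorphic_sym (G H : sgraph) : isomorphic G H -> isomorphic H G.
Proof.
case/isomorphicP => f [g fK gK] f_adj; apply/isomorphicP; exists g; first by exists f.
by move=> a b; rewrite -f_adj !gK.
Qed.

Lemma share_cards_sym (G H : sgraph) (m : nat) : share_cards G H m -> share_cards H G m.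
Proof.
case/share_cardsP => x [y [x_inj y_inj cards]]; apply/share_cardsP.
by exists y, x; split=> // i; apply/isomorphic_sym/cards.
Qed.

(** A one-sided form: used in both directions it compares the girths, infinite ones included. *)
Lemma share_cards_short_cycle (n m : nat) (G H : sgraph) (c : seq G) :
  #|G| = n -> #|H| = n -> 2 * n + 3 <= 3 * m -> share_cards G H m ->
  is_cycle c -> (forall d : seq G, is_cycle d -> size c <= size d) ->
  exists2 d : seq H, is_cycle d & size d <= size c.
Proof.
move=> card_G card_H m_large /share_cardsP[x [y [x_inj y_inj cards]]] cc c_min.
have [/existsP[k /has_cycleP[d cd size_d]]|none] :=
  boolP [exists k : 'I_(size c).+1, has_cycle H k].
  by exists d => //; rewrite size_d -ltnS.
case: (cards_impossible card_G card_H x_inj y_inj cards m_large cc c_min) => d cd.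
rewrite ltnNge; apply: contra none => le_d; apply/existsP.
by exists (Ordinal (le_d : size d < (size c).+1)); apply/has_cycleP; exists d.
Qed.

Theorem theorem3 (n : nat) (G H : sgraph)
    (hn : 3 <= n) (hG : #|G| = n) (hH : #|H| = n)
    (hcommon : ((2%:R * n%:R / 3%:R + 1)%R <= (common_cards G H)%:R :> rat)%R) :
  girth G = girth H.
Proof.
have [] := common_cards_max G H; set m := common_cards G H => GH _.
have HG := share_cards_sym GH.
(* Multiplying by 3 clears the denominator and moves the bound to [nat]. *)
have m_large : 2 * n + 3 <= 3 * m.
  by rewrite -(@Num.Theory.ler_nat rat) GRing.natrD !GRing.natrM; move: hcommon; rewrite -/m; lra.
case girth_G : (girth G) => [k|]; case girth_H : (girth H) => [l|] //.
- have [[c cc <-] c_min] := (girth_SomeP G k).1 girth_G.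
  have [[d cd <-] d_min] := (girth_SomeP H l).1 girth_H.
  have [d' cd' le_d'] := share_cards_short_cycle hG hH m_large GH cc c_min.
  have [c' cc' le_c'] := share_cards_short_cycle hH hG m_large HG cd d_min.
  congr Some; apply/eqP; rewrite eqn_leq (leq_trans (c_min _ cc') le_c').
  exact: leq_trans (d_min _ cd') le_d'.
- have [[c cc <-] c_min] := (girth_SomeP G k).1 girth_G.
  have [d cd _] := share_cards_short_cycle hG hH m_large GH cc c_min.
  by have := (girth_NoneP H).1 girth_H d; rewrite cd.
- have [[d cd <-] d_min] := (girth_SomeP H l).1 girth_H.
  have [c cc _] := share_cards_short_cycle hH hG m_large HG cd d_min.
  by have := (girth_NoneP G).1 girth_G c; rewrite cc.
Qed.
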